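(* Let $s\ge 1$ and $d\ge 0$ be integers and let $X=Z_1+Z_2+\dots+Z_s\subset\mathbb P^2$ be a general union of $s$ 2-squares. Then $$\dim_{\mathbb C} I(X)_d=\max\left\{0,\ \binom{d+2}{2}-4s\right\},$$ equivalently the Hilbert function of $X$ is $H_X(d)=\dim_{\mathbb C}(S_d/I(X)_d)=\min\left\{\binom{d+2}{2},4s\right\}$.
   Context: Work over $\mathbb C$. Let $S=\mathbb C[x,y,z]$ be the homogeneous coordinate ring of $\mathbb P^2$ and $S_d$ the space of forms of degree $d$, so $\dim S_d=\binom{d+2}{2}$. For a closed subscheme $X\subset\mathbb P^2$, $I(X)\subset S$ denotes its saturated homogeneous ideal and $I(X)_d=I(X)\cap S_d$. A 2-square supported at a point $P\in\mathbb P^2$ is the 0-dimensional subscheme $Z$ with $I(Z)=(L_1^2,L_2^2)$, where $L_1,L_2$ are linearly independent linear forms both vanishing at $P$ (it has length 4). For schemes with pairwise disjoint supports, $X_1+\dots+X_s$ denotes their schematic union. A general union of $s$ 2-squares means that the support points are general points of $\mathbb P^2$ and the pairs of lines $\{L_1=0\},\{L_2=0\}$ through each support point are general. *)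

(* Defs.v *)
From Stdlib Require Import Reals.
From HB Require Import structures.
From mathcomp Require Import all_boot all_algebra.
From mathcomp Require Import Rstruct.
From mathcomp.real_closed Require Import complex.
From mathcomp Require Import mpoly.

Set Implicit Arguments.
Unset Strict Implicit.
Unset Printing Implicit Defensive.
Import GRing.Theory.
Local Open Scope ring_scope.

Definition CC : closedFieldType := complex R.

Definition linform (a : 'I_3 -> CC) : {mpoly CC[3]} := \sum_(k < 3) a k *: 'X_k.

(* Cross product in C^3: for linear forms with coefficient vectors a, b, it is
   (homogeneous coordinates of) the common zero; a, b are linearly independent
   iff it is nonzero. *)
Definition cross (a b : 'I_3 -> CC) : 'I_3 -> CC :=
  fun k => match val k with
           | 0%N => a (inord 1) * b (inord 2) - a (inord 2) * b (inord 1)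
           | 1%N => a (inord 2) * b (inord 0) - a (inord 0) * b (inord 2)
           | _ => a (inord 0) * b (inord 1) - a (inord 1) * b (inord 0)
           end.

Definition nonzero3 (a : 'I_3 -> CC) : Prop := exists k, a k != 0.

Definition in_ideal2 (g1 g2 F : {mpoly CC[3]}) : Prop :=
  exists A B : {mpoly CC[3]}, F = A * g1 + B * g2.

Definition in_I_2square (L1 L2 F : {mpoly CC[3]}) : Prop :=
  in_ideal2 (L1 ^+ 2) (L2 ^+ 2) F.

(* Parameter space of s 2-squares: a vector of 6s complex numbers, coordinate
   (i, j, k) being the k-th coefficient of the j-th linear form L_{i,j} of the
   i-th 2-square. *)
Definition param_index (s : nat) := ('I_s * 'I_2 * 'I_3)%type.
Definition nparams (s : nat) : nat := #|{: param_index s}|.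

Definition coef (s : nat) (v : 'I_(nparams s) -> CC) (i : 'I_s) (j : 'I_2)
  : 'I_3 -> CC := fun k => v (enum_rank ((i, j, k) : param_index s)).

Definition Lform (s : nat) (v : 'I_(nparams s) -> CC) (i : 'I_s) (j : 'I_2)
  : {mpoly CC[3]} := linform (coef v i j).

Definition supp_pt (s : nat) (v : 'I_(nparams s) -> CC) (i : 'I_s) : 'I_3 -> CC :=
  cross (coef v i 0) (coef v i 1).

(* v defines s 2-squares with pairwise disjoint supports: in each pair the two
   linear forms are linearly independent, and the support points are pairwise
   distinct points of P^2. *)
Definition valid_config (s : nat) (v : 'I_(nparams s) -> CC) : Prop :=
  (forall i : 'I_s, nonzero3 (supp_pt v i)) /\
  (forall i j : 'I_s, i != j -> nonzero3 (cross (supp_pt v i) (supp_pt v j))).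

Definition IX_d (s : nat) (v : 'I_(nparams s) -> CC) (d : nat)
  (F : {mpoly CC[3]}) : Prop :=
  F \is d.-homog /\ forall i : 'I_s, in_I_2square (Lform v i 0) (Lform v i 1) F.

Definition has_dim (P : {mpoly CC[3]} -> Prop) (n : nat) : Prop :=
  exists b : 'I_n -> {mpoly CC[3]},
    (forall i, P (b i)) /\
    (forall c : 'I_n -> CC, \sum_(i < n) c i *: b i = 0 -> forall i, c i = 0) /\
    (forall F, P F -> exists c : 'I_n -> CC, F = \sum_(i < n) c i *: b i).

(* Main.v *)
(** In coordinates [X_0, a, b] a form [F] of degree [d] lies in the ideal [(a^2, b^2)]
    of a 2-square iff four functionals vanish: [F(P)], [D_u F(P)], [D_w F(P)] and
    [D_u D_w F(P)], where [u], [w] are directions along the two lines through [P]. So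
    [I(X)_d] is the kernel of a matrix whose entries are polynomials in the parameters,
    and it suffices to find one configuration for which this matrix has maximal rank.

    For this we degenerate in the torus. If a set of lattice points is cut by a line
    into four points [B] and a rest [D], and one 2-square imposes independent conditions
    on the monomials of [B] and [s] others do so on [D], then moving the first one along
    the corresponding one-parameter subgroup makes the matrix block triangular in the
    limit, so [s + 1] 2-squares impose independent conditions on [B ++ D]. A general
    2-square is independent on any four noncollinear lattice points. Finally the triangle
    of monomials of degree [d] is cut into such quadruples row by row, three points of a
    row with one point of the next. *)
Require Import Defs.
From Stdlib Require Import Reals FunctionalExtensionality.
From HB Require Import structures.
From mathcomp Require Import all_boot all_algebra.
From mathcomp Require Import Rstruct.
From mathcomp.real_closed Require Import complex.
From mathcomp Require Import mpoly.
From mathcomp Require Import ring zify.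
Import GRing.Theory.
Local Open Scope ring_scope.

Set Implicit Arguments.
Unset Strict Implicit.
Unset Printing Implicit Defensive.

(** * Degeneration along a one-parameter subgroup of the torus *)

Section Peeling.
Variable F : closedFieldType.

(** Linear independence of the rows [e m]; in the applications [f] is the coefficient vector of a
    polynomial supported on [D]. *)
Definition separates (T : eqType) (J : Type) (D : seq T) (e : T -> J -> F) :=
  forall f : T -> F, (forall j, \sum_(m <- D) f m * e m j = 0) ->
  {in D, forall m, f m = 0}.

(** A right inverse [B] of the matrix at [0] makes [p] a polynomial with value [1] at [0]; the extra
    factor ['X] keeps the chosen nonroot away from [0]. *)
Lemma separates_perturb (T : eqType) (J : finType) (D : seq T)
    (g : T -> J -> {poly F}) :
  uniq D -> separates D (fun m j => (g m j).[0]) ->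
  exists2 t, t != 0 & separates D (fun m j => (g m j).[t]).
Proof.
move=> uD sep0.
pose M : 'M[{poly F}]_(size D, #|J|) :=
  \matrix_(i, j) g (tnth (in_tuple D) i) (enum_val j).
pose N t := map_mx (horner_eval t) M.
have NE t (f : T -> F) j : ((\row_i f (tnth (in_tuple D) i)) *m N t) 0 j
    = \sum_(m <- D) f m * (g m (enum_val j)).[t].
  rewrite mxE [RHS]big_tnth; apply: eq_bigr => i _.
  by rewrite !mxE.
have /row_freeP[B NB] : row_free (N 0).
  rewrite -kermx_eq0; apply/rowV0P => u /sub_kermxP uN.
  (* [f] reads [u] through positions in [D], with default [0] outside [D]. *)
  pose f m := oapp (u 0) 0 (insub (index m D) : option 'I_(size D)).
  have fE i : f (tnth (in_tuple D) i) = u 0 i.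
    have iE : index (tnth (in_tuple D) i) D = val i.
      by rewrite (tnth_nth (tnth (in_tuple D) i)) index_uniq.
    by rewrite /f iE valK.
  have uE : \row_i f (tnth (in_tuple D) i) = u.
    by apply/rowP => i; rewrite mxE fE.
  have f0 : {in D, forall m, f m = 0}.
    apply: sep0 => j; rewrite -[j]enum_rankK -NE uE uN mxE //.
  by rewrite -uE; apply/rowP => i; rewrite !mxE f0 ?mem_tnth.
pose p := \det (M *m map_mx polyC B).
have pE t : p.[t] = \det (N t *m B).
  rewrite -horner_evalE -det_map_mx map_mxM; congr (\det (_ *m _)).
  by apply/matrixP => i j; rewrite !mxE; apply: hornerC.
have p0 : 'X * p != 0.
  rewrite mulf_neq0 ?polyX_eq0 //; apply/eqP => p0.
  by have := pE 0; rewrite p0 NB det1 horner0 => /eqP; rewrite eq_sym oner_eq0.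
have /closed_nonrootP[t] := p0.
rewrite rootE hornerM hornerX mulf_eq0 negb_or pE => /andP[t0 dt].
exists t => // f fN m mD.
have uNB : (\row_i f (tnth (in_tuple D) i)) *m (N t *m B) = 0.
  rewrite mulmxA [X in X *m B](_ : _ = 0) ?mul0mx //.
  by apply/rowP => j; rewrite NE fN mxE.
have : N t *m B \in unitmx by rewrite unitmxE unitfE.
move=> U; have := mulmxK U (\row_i f (tnth (in_tuple D) i)); rewrite uNB mul0mx => /rowP.
have /tnthP[i ->] : m \in in_tuple D by [].
by move=> /(_ i); rewrite !mxE.
Qed.

(* [(px, py)] is the support point in the chart [X_0 = 1]; [mu] and [nu] are the
   two directions, divided coordinatewise by the coordinates of the point. *)
Record square := Square { px : F; py : F; mu1 : F; mu2 : F; nu1 : F; nu2 : F }.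

Definition valid (c : square) :=
  [&& px c != 0, py c != 0 & mu1 c * nu2 c - mu2 c * nu1 c != 0].

(* The value, derivatives and mixed second derivative of the monomial
   [x ^ m.1 * y ^ m.2]; in these coordinates rescaling the point only multiplies
   them by a monomial. *)
Definition cond (c : square) (k : 'I_4) (m : nat * nat) : F :=
  let a := m.1%:R in let b := m.2%:R in
  px c ^+ m.1 * py c ^+ m.2 *
  [:: 1; mu1 c * a + mu2 c * b; nu1 c * a + nu2 c * b;
    (mu1 c * a + mu2 c * b) * (nu1 c * a + nu2 c * b)
    - mu1 c * nu1 c * a - mu2 c * nu2 c * b]`_k.

Definition conds (s : nat) (cs : nat -> square) (m : nat * nat)
  (j : 'I_s * 'I_4) : F := cond (cs j.1) j.2 m.
Arguments conds : clear implicits.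

Definition wgt (p q : nat) (m : nat * nat) : nat := p * m.1 + q * m.2.

(* Rescale the new point by [(t ^ p, t ^ q)]: after rescaling rows and columns, the
   evaluation matrix is polynomial in [t] and block triangular at [t = 0]. *)
Lemma separates_peel (p q c : nat) (c0 : square) s cs B D :
    uniq (B ++ D) ->
    {in B, forall m, (wgt p q m < c)%N} -> {in D, forall m, (c <= wgt p q m)%N} ->
    valid c0 -> separates B (fun m k => cond c0 k m) ->
    (forall i, (i < s)%N -> valid (cs i)) -> separates D (conds s cs) ->
  exists2 cs', (forall i, (i < s.+1)%N -> valid (cs' i)) &
               separates (B ++ D) (conds s.+1 cs').
Proof.
move=> uBD ltB leD v0 sB vs sD.
(* Both exponents truncate. At [0] the old squares see only [D], so [f] vanishes there first; the
   new square then sees [B] with factor [1]. *)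
pose g m (j : 'I_s.+1 * 'I_4) : {poly F} :=
  if unlift ord0 j.1 is Some j1
  then 'X^(c - wgt p q m) * (cond (cs j1) j.2 m)%:P
  else 'X^(wgt p q m - c) * (cond c0 j.2 m)%:P.
have [|t t0 sept] := @separates_perturb _ _ (B ++ D) g uBD.
  move=> f fg.
  have fD : {in D, forall m, f m = 0}.
    apply: sD => -[j k]; have := fg (lift ord0 j, k).
    rewrite big_cat big1_seq /= ?add0r => [|m /= mB]; last first.
      rewrite /g /= liftK hornerM hornerXn hornerC expr0n.
      by rewrite subn_eq0 leqNgt ltB // mul0r mulr0.
    move=> E; rewrite -[RHS]E; apply: eq_big_seq => m mD.
    rewrite /g /= liftK hornerM hornerXn hornerC expr0n.
    by rewrite subn_eq0 leD // mul1r.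
  have fB : {in B, forall m, f m = 0}.
    apply: sB => k; have := fg (ord0, k).
    rewrite big_cat /= [X in _ + X]big1_seq /= ?addr0 => [|m /= mD]; last first.
      by rewrite fD // mul0r.
    move=> E; rewrite -[RHS]E; apply: eq_big_seq => m mB.
    rewrite /g /= unlift_none hornerM hornerXn hornerC expr0n.
    by rewrite subn_eq0 (ltnW (ltB _ mB)) mul1r.
  by move=> m; rewrite mem_cat => /orP[/fB|/fD].
pose c1 := Square (px c0 * t ^+ p) (py c0 * t ^+ q) (mu1 c0) (mu2 c0) (nu1 c0) (nu2 c0).
pose cs' i := if i is i'.+1 then cs i' else c1.
have condE k m : cond c1 k m = t ^+ wgt p q m * cond c0 k m.
  rewrite /cond /c1 /wgt /= exprD !exprMn -!exprM; ring.
exists cs' => [[_|i]|].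
- by move: v0; rewrite /valid /= => /and3P[? ? ?]; rewrite !mulf_neq0 ?expf_neq0.
- by rewrite ltnS => /vs.
move=> f fs m mBD.
(* Undoes the scaling of the rows of weight below [c]; the columns of the new square still differ by
   the factor [t ^+ c]. *)
pose h m := if (wgt p q m < c)%N then f m / t ^+ (c - wgt p q m) else f m.
suff : h m = 0.
  rewrite /h; case: ifP => // _ /eqP; rewrite mulf_eq0 invr_eq0 expf_eq0 (negPf t0).
  by rewrite andbF orbF => /eqP.
apply: sept mBD => -[j k]; rewrite /g /=.
have tn n : t ^+ n != 0 by rewrite expf_neq0.
case: unliftP => [j1 _|_].
  have := fs (lift ord0 j1, k) => E; rewrite -[RHS]E; apply: eq_bigr => m' _.
  rewrite /conds /= /h hornerM hornerXn hornerC mulrA; congr (_ * _).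
  case: ltnP => [lt|le]; first by rewrite mulfVK.
  by move: le; rewrite -subn_eq0 => /eqP ->; rewrite mulr1.
have := fs (ord0, k) => E.
have {}E : (t ^+ c)^-1 * \sum_(i <- B ++ D) f i * conds s.+1 cs' i (ord0, k) = 0.
  by rewrite E mulr0.
rewrite -[RHS]E big_distrr /=; apply: eq_bigr => m' _.
rewrite /conds /= condE /h hornerM hornerXn hornerC !mulrA; congr (_ * _).
case: ltnP => [lt|le].
  have := ltnW lt; rewrite -subn_eq0 => /eqP ->; rewrite mulr1.
  rewrite -[in RHS](subnKC (ltnW lt)) exprD.
  by field; rewrite !tn.
rewrite -[in RHS](subnKC le) exprD.
by field; rewrite !tn.
Qed.

End Peeling.
Arguments conds {F} s cs m j.

(** * Lattice point sets on which squares impose independent conditions *)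

Section Lattice.
Variable F : closedFieldType.
Hypothesis F_char0 : forall n : nat, n.+1%:R != 0 :> F.

Implicit Types B D : seq (nat * nat).

Definition separable B := exists2 c : square F, valid c &
  separates B (fun m k => cond c k m).

(** Maximal rank in row form. [D'] may depend on [s], which allows peeling one block per square. *)
Definition splits D := forall s, exists D', [/\ {subset D' <= D}, uniq D',
  size D' = minn (4 * s) (size D) &
  exists2 cs : nat -> square F, (forall i, (i < s)%N -> valid (cs i)) &
                                separates D' (conds s cs)].

(** One square is spent on [B] and the others on [D]. *)
Lemma splits_peel (p q c : nat) B D :
    uniq B -> size B = 4 -> separable B ->
    {in B, forall m, (wgt p q m < c)%N} -> {in D, forall m, (c <= wgt p q m)%N} ->
  splits D -> splits (B ++ D).
Proof.
move=> uB szB [c0 v0 sB] ltB leD spD [|s].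
  exists [::]; split; rewrite ?muln0 ?min0n //; exists (fun=> c0) => //.
have [D' [sub uD szD [cs vs sD]]] := spD s.
exists (B ++ D'); split.
- by move=> m; rewrite !mem_cat => /orP[->//|/sub ->]; rewrite orbT.
- rewrite cat_uniq uB uD andbT /=; apply/hasPn => m /sub/leD.
  by rewrite leqNgt; apply: contra => /ltB.
- by rewrite !size_cat szD szB; lia.
apply: (separates_peel _ ltB _ v0 sB vs sD); last by move=> m /sub/leD.
rewrite cat_uniq uB uD andbT /=; apply/hasPn => m /sub/leD.
by rewrite leqNgt; apply: contra => /ltB.
Qed.

(** One square is independent on all of [B]; repeating it only adds conditions. *)
Lemma splits_separable B : uniq B -> (size B <= 4)%N -> separable B -> splits B.
Proof.
move=> uB szB [c0 v0 sB] [|s].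
  exists [::]; split; rewrite ?muln0 ?min0n //; exists (fun=> c0) => //.
exists B; split=> //; first by lia.
by exists (fun=> c0) => // f fs; apply: sB => k; apply: (fs (ord0, k)).
Qed.

Lemma splits_perm D1 D2 : perm_eq D1 D2 -> splits D1 -> splits D2.
Proof.
move=> pD sp s; have [D' [sub uD szD cs]] := sp s.
exists D'; split=> //; last by rewrite szD (perm_size pD).
by move=> m /sub; rewrite (perm_mem pD).
Qed.

Lemma natr_inj_char0 : injective (fun n : nat => n%:R : F).
Proof.
move=> m n /eqP E; apply/eqP; move: E; wlog le_mn : m n / (m <= n)%N.
  by move=> W; case: (leqP m n) => [/W//|/ltnW/W]; rewrite eq_sym (eq_sym n).
rewrite eq_sym -subr_eq0 -natrB //; case E : (n - m)%N => [|k].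
  by rewrite eqn_leq le_mn /= => _; rewrite -subn_eq0 E.
by rewrite (negPf (F_char0 k)).
Qed.

(* Take [mu = (1, 0)]: the quadratic condition is then [nu.1 a^2 + nu.2 a b] up to
   the linear ones. *)
Lemma separable_intro B (nu : F * F) : nu.2 != 0 ->
    (forall f : nat * nat -> F,
       \sum_(m <- B) f m = 0 -> \sum_(m <- B) f m * m.1%:R = 0 ->
       \sum_(m <- B) f m * m.2%:R = 0 ->
       \sum_(m <- B) f m * (nu.1 * (m.1%:R * m.1%:R) + nu.2 * (m.1%:R * m.2%:R)) = 0 ->
       {in B, forall m, f m = 0}) ->
  separable B.
Proof.
move=> nu0 H; exists (Square 1 1 1 0 nu.1 nu.2).
  by rewrite /valid /= oner_eq0 mul1r mul0r subr0.
move=> f fs.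
have E0 : \sum_(m <- B) f m = 0.
  rewrite -[RHS](fs (inord 0)); apply: eq_bigr => m _.
  by rewrite /cond /= inordK //= !expr1n !mulr1.
have E1 : \sum_(m <- B) f m * m.1%:R = 0.
  rewrite -[RHS](fs (inord 1)); apply: eq_bigr => m _.
  by rewrite /cond /= inordK //= !expr1n; ring.
have E2 : \sum_(m <- B) f m * m.2%:R = 0.
  apply: (mulfI nu0); rewrite mulr0.
  rewrite -[RHS](fs (inord 2)) -[LHS]addr0 -[X in _ + X](mulr0 nu.1) -[X in _ + _ * X]E1.
  rewrite !big_distrr -big_split /=; apply: eq_bigr => m _.
  by rewrite /cond /= inordK //= !expr1n; ring.
apply: H => //.
rewrite -[RHS](fs (inord 3)) -[LHS]addr0 -[X in _ + X](mulr0 (- nu.1)) -[X in _ + _ * X]E1.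
rewrite big_distrr -big_split /=; apply: eq_bigr => m _.
by rewrite /cond /= inordK //= !expr1n; ring.
Qed.

Definition hrow r a n : seq (nat * nat) := [seq (i, r) | i <- iota a n].

(** Rows of lengths [n], [n - 1], ..., [1] from row [r] upwards; [tri 0 d.+1] indexes the monomials
    of degree [d] by their last two exponents. *)
Fixpoint tri r n : seq (nat * nat) :=
  if n is n'.+1 then hrow r 0 n ++ tri r.+1 n' else [::].

Lemma linear_combination (c1 c2 e1 e2 x y : F) :
  e1 = 0 -> e2 = 0 -> x - y = c1 * e1 + c2 * e2 -> x = y.
Proof. by move=> -> -> /eqP; rewrite !mulr0 addr0 subr_eq0 => /eqP. Qed.
Arguments linear_combination c1 c2 {e1 e2 x y}.

(** The first two equations leave multiples of the second difference [(1, -2, 1)], on which the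
    quadratic function takes the value [2 * b]. *)
Lemma second_difference0 (a x y z : F) (b c : F) : b != 0 ->
  x + y + z = 0 -> x * a + y * (a + 1) + z * (a + 1 + 1) = 0 ->
  x * (b * (a * a) + c * a) + y * (b * ((a + 1) * (a + 1)) + c * (a + 1))
    + z * (b * ((a + 1 + 1) * (a + 1 + 1)) + c * (a + 1 + 1)) = 0 ->
  [/\ x = 0, y = 0 & z = 0].
Proof.
move=> b0 e0 e1 e3.
have yz : y = - z * 2%:R by apply: (linear_combination (- a) 1 e0 e1); ring.
have xz : x = z by apply: (linear_combination 1 1 e0 erefl); rewrite yz; ring.
have z0 : z = 0.
  by apply: (mulfI (mulf_neq0 b0 (F_char0 1))); rewrite mulr0 -[RHS]e3 yz xz; ring.
by rewrite xz yz z0; split=> //; ring.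
Qed.

(** The second coordinate is constant on the triple, so [e2 - r * e0] isolates the lone point;
    second differences settle the triple. *)
Lemma separable_row3_point r a b :
  separable [:: (a, r); (a.+1, r); (a.+2, r); (b, r.+1)].
Proof.
apply: (@separable_intro _ (1, 1)); first exact: oner_neq0.
move=> f; rewrite !big_cons !big_nil /= -!natr1.
set x := f (a, r); set y := f (a.+1, r); set z := f (a.+2, r).
set w := f (b, r.+1) => e0 e1 e2 e3.
have w0 : w = 0 by apply: (linear_combination (- r%:R) 1 e0 e2); ring.
rewrite w0 in e0 e1 e3.
have [|||x0 y0 z0] := @second_difference0 a%:R x y z 1 r%:R (oner_neq0 _).
- by rewrite -[RHS]e0; ring.
- by rewrite -[RHS]e1; ring.
- by rewrite -[RHS]e3; ring.
by move=> m; rewrite !inE => /or4P[]/eqP->.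
Qed.

Lemma separable_point_row3 r a b :
  separable [:: (a, r); (b, r.+1); (b.+1, r.+1); (b.+2, r.+1)].
Proof.
apply: (@separable_intro _ (1, 1)); first exact: oner_neq0.
move=> f; rewrite !big_cons !big_nil /= -!natr1.
set x := f (b, r.+1); set y := f (b.+1, r.+1); set z := f (b.+2, r.+1).
set w := f (a, r) => e0 e1 e2 e3.
have w0 : w = 0 by apply: (linear_combination (r%:R + 1) (- 1) e0 e2); ring.
rewrite w0 in e0 e1 e3.
have [|||x0 y0 z0] := @second_difference0 b%:R x y z 1 (r%:R + 1) (oner_neq0 _).
- by rewrite -[RHS]e0; ring.
- by rewrite -[RHS]e1; ring.
- by rewrite -[RHS]e3; ring.
by move=> m; rewrite !inE => /or4P[]/eqP->.
Qed.

(** The affine conditions force the pattern [(w, -w, -w, w)]; the quadratic one becomes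
    [w * (2 * b + 1 - 2 * a) = 0], whose second factor is nonzero by parity. *)
Lemma separable_row2_row2 r a b :
  separable [:: (a, r); (a.+1, r); (b, r.+1); (b.+1, r.+1)].
Proof.
apply: (@separable_intro _ (1, 1)); first exact: oner_neq0.
move=> f; rewrite !big_cons !big_nil /= -!natr1.
set x := f (a, r); set y := f (a.+1, r); set z := f (b, r.+1).
set w := f (b.+1, r.+1) => e0 e1 e2 e3.
have zw : z = - w by apply: (linear_combination (- r%:R) 1 e0 e2); ring.
have xy : x = - y by apply: (linear_combination 1 1 e0 erefl); rewrite zw; ring.
have yw : y = - w by apply: (linear_combination 1 1 e1 erefl); rewrite zw xy; ring.
have w0 : w = 0.
  apply/eqP; case: (eqVneq w 0) => // wn0.
  have /natr_inj_char0 : (2 * a)%:R = (2 * b).+1%:R :> F.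
    apply: (mulfI wn0); apply: (linear_combination (- 1) 1 e3 erefl).
    by rewrite xy yw zw -natr1 !natrM; ring.
  by lia.
have y0 : y = 0 by rewrite yw w0 oppr0.
have x0 : x = 0 by rewrite xy y0 oppr0.
have z0 : z = 0 by rewrite zw w0 oppr0.
by move=> m; rewrite !inE => /or4P[]/eqP->.
Qed.

(** Three of the points lie on a line where [a + b] is constant and [a^2 + a b] is affine; hence
    [nu = (0, 1)]. In [(r + 1) * e1 - e3] row [r.+1] cancels and the last point has first coordinate
    [0], leaving [2 * x]. *)
Lemma separable_point_row2_point r :
  separable [:: (2, r); (0, r.+1); (1, r.+1); (0, r.+2)].
Proof.
apply: (@separable_intro _ (0, 1)); first exact: oner_neq0.
move=> f; rewrite !big_cons !big_nil /= -!natr1.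
set x := f (2, r); set y := f (0, r.+1); set z := f (1, r.+1).
set w := f (0, r.+2) => e0 e1 e2 e3.
have zx : z = - x * 2%:R by apply: (linear_combination 1 1 e1 erefl); ring.
have x0 : x = 0.
  apply: (mulfI (F_char0 1)).
  by apply: (linear_combination (r%:R + 1) (- 1) e1 e3); ring.
have z0 : z = 0 by rewrite zx x0; ring.
have yw : y = - w by apply: (linear_combination 1 1 e0 erefl); rewrite x0 z0; ring.
have w0 : w = 0.
  by apply: (linear_combination (- (r%:R + 1)) 1 e0 e2); rewrite x0 z0; ring.
have y0 : y = 0 by rewrite yw w0 oppr0.
by move=> m; rewrite !inE => /or4P[]/eqP->.
Qed.

(** The same combination [(r + 1) * e1 - e3] now leaves [3 * x]. *)
Lemma separable_point_row2_point' r :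
  separable [:: (3, r); (1, r.+1); (2, r.+1); (0, r.+2)].
Proof.
apply: (@separable_intro _ (0, 1)); first exact: oner_neq0.
move=> f; rewrite !big_cons !big_nil /= -!natr1.
set x := f (3, r); set y := f (1, r.+1); set z := f (2, r.+1).
set w := f (0, r.+2) => e0 e1 e2 e3.
have x0 : x = 0.
  apply: (mulfI (F_char0 2)).
  by apply: (linear_combination (r%:R + 1) (- 1) e1 e3); ring.
have yz : y = - z * 2%:R.
  by apply: (linear_combination 1 1 e1 erefl); rewrite x0; ring.
have wz : w = z by apply: (linear_combination 1 1 e0 erefl); rewrite x0 yz; ring.
have z0 : z = 0.
  by apply: (linear_combination (- (r%:R + 1)) 1 e0 e2); rewrite x0 yz wz; ring.
have w0 : w = 0 by rewrite wz.
have y0 : y = 0 by rewrite yz z0; ring.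
by move=> m; rewrite !inE => /or4P[]/eqP->.
Qed.

Lemma separable_triangle r : separable [:: (0, r); (1, r); (0, r.+1)].
Proof.
apply: (@separable_intro _ (1, 1)); first exact: oner_neq0.
move=> f; rewrite !big_cons !big_nil /= -!natr1.
set x := f (0, r); set y := f (1, r); set z := f (0, r.+1) => e0 e1 e2 _.
have y0 : y = 0 by rewrite -e1; ring.
have z0 : z = 0 by apply: (linear_combination (- r%:R) 1 e0 e2); ring.
have x0 : x = 0 by rewrite -e0 y0 z0; ring.
by move=> m; rewrite !inE => /or3P[]/eqP->.
Qed.

(** Functions on [B'] are extended by zero to [B]. *)
Lemma separable_sub B B' : uniq B -> uniq B' -> {subset B' <= B} ->
  separable B -> separable B'.
Proof.
move=> uB uB' sub [c v sB]; exists c => // f fs m mB'.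
pose g m := if m \in B' then f m else 0.
suff: g m = 0 by rewrite /g mB'.
apply: sB (sub _ mB') => k; rewrite -[RHS](fs k).
rewrite (eq_bigr (fun m => if m \in B' then f m * cond c k m else 0)); last first.
  by move=> i _; rewrite /g; case: ifP; rewrite ?mul0r.
rewrite -big_mkcond -big_filter; apply: perm_big.
apply: uniq_perm => //; first exact: filter_uniq.
by move=> i; rewrite mem_filter; case E : (_ \in B') => //=; apply: sub.
Qed.

Lemma mem_hrow r a n m : (m \in hrow r a n) = [&& m.2 == r, a <= m.1 & m.1 < a + n]%N.
Proof.
case: m => i j; apply/mapP/and3P => /= [[i' + [-> ->]]|[/eqP-> ge lt]].
  by rewrite mem_iota => /andP[].
by exists i => //; rewrite mem_iota ge.
Qed.

Lemma triS r n : tri r n.+1 = hrow r 0 n.+1 ++ tri r.+1 n.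
Proof. by []. Qed.

Lemma mem_tri r n m : (m \in tri r n) = [&& r <= m.2 & m.1 + m.2 < r + n]%N.
Proof.
elim: n r => [|n IH] r; first by rewrite in_nil; lia.
by rewrite triS mem_cat mem_hrow IH; lia.
Qed.

(* Peel triples of row [r] together with one point of row [r.+1]; the functional
   [a + q b] with [q = a + 2 - b] cuts off such a block, and the last [k] points of
   row [r] are completed by [j] points of row [r.+1]. *)
Lemma splits_hrow K r a b n k j rest :
    (k, j) \in [:: (0, 0); (1, 3); (2, 2)]%N -> (2 * b <= a.+1)%N ->
    {in rest, forall m, r.+2 <= m.2}%N ->
    splits (hrow r.+1 (b + K + j) n ++ rest) ->
  splits (hrow r a (3 * K + k) ++ hrow r.+1 b (K + j + n) ++ rest).
Proof.
move=> kj; elim: K a b => [|K IH] a b ba lt_rest sp.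
  (* For the last block of the row, the weight [a + Q b] with [Q] large orders points by row first,
     then by first coordinate. *)
  have lex B : splits (hrow r.+1 (b + j) n ++ rest) ->
      {in B, forall m, m.1 <= a.+1 /\ m.2 = r \/ m.1 < b + j /\ m.2 = r.+1}%N ->
      uniq B -> size B = 4 -> separable B ->
    splits (B ++ hrow r.+1 (b + j) n ++ rest).
    move=> {}sp inB uB szB sB.
    pose Q := (a + b + j).+2.
    apply: (@splits_peel 1 Q (b + j + Q * r.+1)) => // m.
      move=> /inB[] [lt1 e2]; rewrite /wgt mul1n e2; last by lia.
      by rewrite mulnS /Q; lia.
    rewrite mem_cat mem_hrow /wgt mul1n => /orP[/and3P[/eqP-> ge _]|/lt_rest le].
      by rewrite leq_add2r.
    apply: leq_trans (leq_trans (leq_mul (leqnn Q) le) (leq_addl _ _)).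
    by rewrite !mulnS /Q; lia.
  move: kj; rewrite addn0 in sp; rewrite !inE => /or3P[]/eqP[? ?]; subst k j.
  - by rewrite addn0 in sp.
  - rewrite addn3 in sp lex; apply: (lex [:: (a, r); (b, r.+1); (b.+1, r.+1); (b.+2, r.+1)]) => //.
    + by move=> m; rewrite !inE => /or4P[]/eqP->/=; lia.
    + by rewrite /= !inE !xpair_eqE; lia.
    + exact: separable_point_row3.
  - rewrite addn2 in sp lex; apply: (lex [:: (a, r); (a.+1, r); (b, r.+1); (b.+1, r.+1)]) => //.
    + by move=> m; rewrite !inE => /or4P[]/eqP->/=; lia.
    + by rewrite /= !inE !xpair_eqE; lia.
    + exact: separable_row2_row2.
have -> : (3 * K.+1 + k = (3 * K + k).+3)%N by lia.
have -> : (K.+1 + j + n = (K + j + n).+1)%N by lia.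
pose B := [:: (a, r); (a.+1, r); (a.+2, r); (b, r.+1)].
apply: (@splits_perm (B ++ hrow r a.+3 (3 * K + k) ++ hrow r.+1 b.+1 (K + j + n) ++ rest)).
  rewrite !perm_cons; apply: permEl.
  exact: (perm_catCA [:: (b, r.+1)] (hrow r a.+3 (3 * K + k)) (hrow r.+1 b.+1 (K + j + n) ++ rest)).
(* This slope gives [(a.+2, r)] and [(b, r.+1)] the same weight, one below the cut. Rows from [r.+2]
   on lie above it once [a + 3 <= 2 * q], which is [2 * b <= a.+1]. *)
have [q qE] : exists q, (q + b = a + 2)%N by exists (a + 2 - b)%N; lia.
apply: (@splits_peel 1 q (a + 3 + q * r)) => //.
- by rewrite /= !inE !xpair_eqE; lia.
- exact: separable_row3_point.
- by move=> m; rewrite /wgt mul1n !inE => /or4P[]/eqP->/=; rewrite ?mulnS; lia.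
- case=> i x; rewrite !mem_cat !mem_hrow /wgt mul1n /= => /or3P[/and3P[/eqP-> ? _]|/and3P[/eqP-> ? _]|].
  + by lia.
  + by rewrite mulnS; lia.
  + move=> /lt_rest le; apply: leq_trans (leq_trans (leq_mul (leqnn q) le) (leq_addl _ _)).
    by rewrite !mulnS; lia.
apply: IH => //; first by lia.
by rewrite addSnnS.
Qed.

Lemma splits_sub_triangle r B : uniq B -> (size B <= 4)%N ->
  {subset B <= [:: (0, r); (1, r); (0, r.+1)]} -> splits B.
Proof.
move=> uB szB sub; apply: splits_separable => //.
apply: separable_sub (separable_triangle r) => //.
by rewrite /= !inE !xpair_eqE; lia.
Qed.

(** The generic pattern would take four points from row [r.+1], which has three; the second block
    borrows one from row [r.+2] instead. *)
Lemma splits_row4_tri3 r : splits (hrow r 0 4 ++ tri r.+1 3).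
Proof.
pose B := [:: (0, r); (1, r); (2, r); (0, r.+1)]%N.
pose C := [:: (3, r); (1, r.+1); (2, r.+1); (0, r.+2)]%N.
pose D := [:: (1, r.+2); (0, r.+3)]%N.
apply: (@splits_perm (B ++ C ++ D)).
  by rewrite !perm_cons; apply: permEl; apply: (perm_catCA [:: (0, r.+1)%N] [:: (3, r)%N]).
apply: (@splits_peel 1 2 (3 + 2 * r)) => //.
- by rewrite /= !inE !xpair_eqE; lia.
- exact: separable_row3_point.
- by move=> m; rewrite !inE => /or4P[]/eqP->; rewrite /wgt /=; lia.
- move=> m; rewrite mem_cat !inE -!orbA /wgt.
  by do ![case/orP; first by move/eqP->; rewrite /=; lia]; move/eqP->; rewrite /=; lia.
apply: (@splits_peel 1 10 (1 + 10 * r.+2)) => //.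
- exact: separable_point_row2_point'.
- by move=> m; rewrite !inE => /or4P[]/eqP->; rewrite /wgt /=; lia.
- by move=> m; rewrite !inE => /orP[]/eqP->; rewrite /wgt /=; lia.
apply: (@splits_sub_triangle r.+2) => //.
by move=> m; rewrite !inE => /orP[]/eqP->; rewrite eqxx ?orbT.
Qed.

(* Two small shapes do not decompose along the generic pattern: [n = 2, L = 1],
   where [nu = (1, 1)] is degenerate, and [n = 3, L = 4]. *)
Lemma splits_state n r a L : (a + L = n.+1)%N -> splits (hrow r a L ++ tri r.+1 n).
Proof.
elim: n r a L => [|n IH] r a L aL.
  apply: (@splits_sub_triangle r).
  - by rewrite cats0 map_inj_uniq ?iota_uniq // => i j [].
  - by rewrite cats0 size_map size_iota; lia.
  - case=> i j; rewrite cats0 mem_hrow !inE !xpair_eqE /=; lia.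
have [n0|n_gt0] := posnP n.
  subst n; apply: (@splits_sub_triangle r).
  - rewrite cat_uniq map_inj_uniq ?iota_uniq ?andbT //=; last by move=> i j [].
    by rewrite mem_hrow /=; lia.
  - by rewrite size_cat size_map size_iota /=; lia.
  - case=> i j; rewrite mem_cat mem_hrow !inE !xpair_eqE /=; lia.
have [/andP[/eqP n1 /eqP L1]|n1] := boolP ((n == 1) && (L == 1))%N.
  subst n L; have -> : a = 2 by lia.
  apply: splits_separable => //; last exact: separable_point_row2_point.
  by rewrite /= !inE !xpair_eqE; lia.
have [/andP[/eqP n2 /eqP L4]|n2] := boolP ((n == 2) && (L == 4))%N.
  subst n L; have -> : a = 0%N by lia.
  exact: splits_row4_tri3.
(* The number of points of row [r.+1] completing the last [L %% 3] points of row [r] to a block of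
   four; in the shapes left, row [r.+1] is long enough. *)
pose j := nth 0%N [:: 0; 3; 2]%N (L %% 3).
have L3 : (L %% 3 < 3)%N by rewrite ltn_mod.
have LE : (L = 3 * (L %/ 3) + L %% 3)%N by rewrite mulnC -divn_eq.
have [Lj jE] : ((L %% 3)%N, j) \in [:: (0, 0); (1, 3); (2, 2)]%N /\ (L %/ 3 + j <= n.+1)%N.
  rewrite /j; case: (L %% 3)%N L3 LE => [|[|[|//]]] _ LE; split=> //=; lia.
rewrite {1}LE triS -{1}(subnKC jE).
apply: splits_hrow => //; first by move=> m; rewrite mem_tri => /andP[].
by rewrite add0n; apply: IH; rewrite subnKC.
Qed.

Lemma splits_tri r n : splits (tri r n).
Proof.
case: n => [|n]; first exact: (@splits_sub_triangle r).
exact: (@splits_state n r 0 n.+1 (add0n _)).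
Qed.

End Lattice.

Arguments tri : simpl never.

(** * Membership in [(a^2, b^2)] through four linear functionals *)

Section DoubleIdeal.
Variable K : fieldType.

(* Over an arbitrary field; at [CC], [lform] and [crossp] are convertible to
   [linform] and [cross]. *)
Definition lform (a : 'I_3 -> K) : {mpoly K[3]} := \sum_(k < 3) a k *: 'X_k.

Definition crossp (a b : 'I_3 -> K) : 'I_3 -> K :=
  fun k => match val k with
           | 0%N => a (inord 1) * b (inord 2) - a (inord 2) * b (inord 1)
           | 1%N => a (inord 2) * b (inord 0) - a (inord 0) * b (inord 2)
           | _ => a (inord 0) * b (inord 1) - a (inord 1) * b (inord 0)
           end.

Lemma sum3E (V : nmodType) (f : 'I_3 -> V) :
  \sum_(k < 3) f k = f (inord 0) + f (inord 1) + f (inord 2).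
Proof.
rewrite !big_ord_recl big_ord0 addr0 addrA.
by congr (f _ + f _ + f _); apply/val_inj; rewrite /= inordK.
Qed.

Lemma forall3 (P : 'I_3 -> Prop) :
  P (inord 0) -> P (inord 1) -> P (inord 2) -> forall k, P k.
Proof.
move=> P0 P1 P2 [[|[|[|//]]] lt].
- by rewrite (_ : Ordinal lt = inord 0) //; apply: val_inj; rewrite /= inordK.
- by rewrite (_ : Ordinal lt = inord 1) //; apply: val_inj; rewrite /= inordK.
- by rewrite (_ : Ordinal lt = inord 2) //; apply: val_inj; rewrite /= inordK.
Qed.

Implicit Types (a b u w x : 'I_3 -> K) (p q : {mpoly K[3]}).

Definition dot a x : K := \sum_k a k * x k.

Definition dirder u p : {mpoly K[3]} := \sum_k u k *: p^`M(k).

Lemma dirderD u p q : dirder u (p + q) = dirder u p + dirder u q.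
Proof.
by rewrite -big_split /=; apply: eq_bigr => k _; rewrite mderivD scalerDr.
Qed.

Lemma dirderZ u c p : dirder u (c *: p) = c *: dirder u p.
Proof.
rewrite scaler_sumr; apply: eq_bigr => k _.
by rewrite mderivZ !scalerA mulrC.
Qed.

Lemma dirderM u p q : dirder u (p * q) = dirder u p * q + p * dirder u q.
Proof.
rewrite mulr_suml mulr_sumr -big_split /=; apply: eq_bigr => k _.
by rewrite mderivM scalerDr scalerAl scalerAr.
Qed.

Lemma dirderC u c : dirder u c%:MP = 0.
Proof. by apply: big1 => k _; rewrite mderivC scaler0. Qed.

Lemma dirderXU u i : dirder u 'X_i = (u i)%:MP.
Proof.
rewrite /dirder (bigD1 i) //= big1 ?addr0 => [|k ki].
  by rewrite mderivX mnm1E eqxx scale1r -{1}[U_(i)%MM]add0m addmK mpolyX0 -mul_mpolyC mulr1.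
by rewrite mderivX mnm1E eq_sym (negPf ki) scale0r scaler0.
Qed.

Lemma dirder_sum u (I : Type) (r : seq I) (g : I -> {mpoly K[3]}) :
  dirder u (\sum_(i <- r) g i) = \sum_(i <- r) dirder u (g i).
Proof.
elim: r => [|i r IH]; first by rewrite !big_nil -mpolyC0 dirderC.
by rewrite !big_cons dirderD IH.
Qed.

Lemma dirder_lform u a : dirder u (lform a) = (dot a u)%:MP.
Proof.
rewrite dirder_sum /dot rmorph_sum; apply: eq_bigr => k _ /=.
by rewrite dirderZ dirderXU -mul_mpolyC -mpolyCM.
Qed.

Lemma meval_lform x a : (lform a).@[x] = dot a x.
Proof.
rewrite raddf_sum /dot; apply: eq_bigr => k _ /=.
by rewrite mevalZ mevalXU.
Qed.

(* The directions of the lines [a = 0] and [b = 0] that lie on the line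
   [X_0 = 0] are [dirvec a] and [dirvec b]. *)
Definition dirvec a : 'I_3 -> K := fun k =>
  match val k with 0%N => 0 | 1%N => a (inord 2) | _ => - a (inord 1) end.

Lemma dirvecE a : (dirvec a (inord 0) = 0) * (dirvec a (inord 1) = a (inord 2))
  * (dirvec a (inord 2) = - a (inord 1)).
Proof. by rewrite /dirvec /= !inordK. Qed.

Lemma crossE a b :
  (crossp a b (inord 0) = a (inord 1) * b (inord 2) - a (inord 2) * b (inord 1)) *
  (crossp a b (inord 1) = a (inord 2) * b (inord 0) - a (inord 0) * b (inord 2)) *
  (crossp a b (inord 2) = a (inord 0) * b (inord 1) - a (inord 1) * b (inord 0)).
Proof. by rewrite /crossp /= !inordK. Qed.

Definition phi a b (k : 'I_4) p : K :=
  [:: p.@[crossp a b]; (dirder (dirvec b) p).@[crossp a b];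
      (dirder (dirvec a) p).@[crossp a b];
      (dirder (dirvec b) (dirder (dirvec a) p)).@[crossp a b]]`_k.

Lemma dot_cross a b :
  (dot a (crossp a b) = 0) * (dot b (crossp a b) = 0) *
  (dot a (dirvec a) = 0) * (dot b (dirvec b) = 0) *
  (dot a (dirvec b) = crossp a b (inord 0)) *
  (dot b (dirvec a) = - crossp a b (inord 0)).
Proof. by rewrite /dot !sum3E !crossE !dirvecE; do !split; ring. Qed.

Lemma phiD a b k p q : phi a b k (p + q) = phi a b k p + phi a b k q.
Proof.
by rewrite /phi !dirderD !mevalD; case: k => [[|[|[|[|//]]]] lt].
Qed.

Lemma phiZ a b k c p : phi a b k (c *: p) = c * phi a b k p.
Proof.
by rewrite /phi !dirderZ !mevalZ; case: k => [[|[|[|[|//]]]] lt].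
Qed.

Lemma phi_sum a b k (I : Type) (r : seq I) (c : I -> K) (g : I -> {mpoly K[3]}) :
  phi a b k (\sum_(i <- r) c i *: g i) = \sum_(i <- r) c i * phi a b k (g i).
Proof.
elim: r => [|i r IH]; first by rewrite !big_nil -(scale0r 0) phiZ mul0r.
by rewrite !big_cons phiD phiZ IH.
Qed.

(** The square vanishes to order two at the point, so only the mixed second derivative survives, as
    twice a product of slopes. For [c = a] or [c = b] one slope is zero. *)
Lemma phi_square a b k p c :
    dot c (crossp a b) = 0 -> dot c (dirvec a) * dot c (dirvec b) = 0 ->
  phi a b k (p * lform c ^+ 2) = 0.
Proof.
move=> cP cab; rewrite /phi expr2.
do !rewrite ?dirderM ?dirderD ?dirder_lform ?dirderC.
rewrite !(mevalD, mevalM, mevalC, meval0) !meval_lform !cP.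
case: k => [[|[|[|[|//]]]] lt] /=; try by ring.
transitivity (2%:R * p.@[crossp a b] * (dot c (dirvec a) * dot c (dirvec b))); first by ring.
by rewrite cab mulr0.
Qed.

Definition in_sqideal a b p :=
  exists A B, p = A * lform a ^+ 2 + B * lform b ^+ 2.

Lemma phi_ideal a b k p : in_sqideal a b p -> phi a b k p = 0.
Proof.
have [[[[[aP bP] aa] bb] _] _] := dot_cross a b.
move=> [A [B ->]]; rewrite phiD !phi_square ?addr0 //.
  by rewrite bb mulr0.
by rewrite aa mul0r.
Qed.

(* The classes of [X_0^d], [X_0^(d-1) a], [X_0^(d-1) b], [X_0^(d-2) a b] span
   degree [d] modulo [(a^2, b^2)]; the side conditions discard those with a
   truncated exponent. *)
Definition normal_form a b d p := exists A B c0 c1 c2 c3,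
  [/\ (d = 0%N -> c1 = 0 /\ c2 = 0), ((d <= 1)%N -> c3 = 0) &
  p = A * lform a ^+ 2 + B * lform b ^+ 2 +
      c0%:MP * 'X_(inord 0) ^+ d + c1%:MP * ('X_(inord 0) ^+ d.-1 * lform a)
      + c2%:MP * ('X_(inord 0) ^+ d.-1 * lform b)
      + c3%:MP * ('X_(inord 0) ^+ d.-2 * (lform a * lform b))].

Lemma normal_form0 a b d : normal_form a b d 0.
Proof. by exists 0, 0, 0, 0, 0, 0; split=> //; rewrite mpolyC0; ring. Qed.

Lemma normal_formD a b d c p q :
  normal_form a b d p -> normal_form a b d q -> normal_form a b d (c%:MP * p + q).
Proof.
move=> [A [B [c0 [c1 [c2 [c3 [h1 h3 ->]]]]]]] [A' [B' [c0' [c1' [c2' [c3' [h1' h3' ->]]]]]]].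
exists (c%:MP * A + A'), (c%:MP * B + B'), (c * c0 + c0'), (c * c1 + c1'),
  (c * c2 + c2'), (c * c3 + c3'); split.
- by move=> d0; have [-> ->] := h1 d0; have [-> ->] := h1' d0; rewrite mulr0 addr0.
- by move=> d1; rewrite h3 // h3' // mulr0 addr0.
- by rewrite !mpolyCD !mpolyCM; ring.
Qed.

Lemma normal_form_X0 a b d p :
  normal_form a b d p -> normal_form a b d.+1 ('X_(inord 0) * p).
Proof.
move=> [A [B [c0 [c1 [c2 [c3 [h1 h3 ->]]]]]]].
exists ('X_(inord 0) * A), ('X_(inord 0) * B), c0, c1, c2, c3; split=> //.
  by move=> d0; apply: h3; lia.
(* For [d <= 1] the truncated exponents do not grow with [d]; the side conditions kill the affected
   terms. *)
case: d h1 h3 => [|[|d]] h1 h3 /=; last by rewrite !exprS; ring.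
  by have [-> ->] := h1 erefl; rewrite h3 // mpolyC0 !exprS; ring.
by rewrite h3 // mpolyC0 !exprS; ring.
Qed.

Lemma normal_form_a a b d p :
  normal_form a b d p -> normal_form a b d.+1 (lform a * p).
Proof.
move=> [A [B [c0 [c1 [c2 [c3 [h1 h3 ->]]]]]]].
(* The terms in [a] and [a b] acquire [a^2] and enter the ideal; [c0] and [c2] move to the positions
   of [a] and [a b]. *)
exists (lform a * A + c1%:MP * 'X_(inord 0) ^+ d.-1 +
    c3%:MP * 'X_(inord 0) ^+ d.-2 * lform b), (lform a * B), 0, c0, 0, c2; split=> //.
  by rewrite ltnS leqn0 => /eqP /h1[].
by rewrite !mpolyC0 /=; ring.
Qed.

Lemma normal_form_b a b d p :
  normal_form a b d p -> normal_form a b d.+1 (lform b * p).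
Proof.
move=> [A [B [c0 [c1 [c2 [c3 [h1 h3 ->]]]]]]].
exists (lform b * A), (lform b * B + c2%:MP * 'X_(inord 0) ^+ d.-1 +
    c3%:MP * 'X_(inord 0) ^+ d.-2 * lform a), 0, 0, c0, c1; split=> //.
  by rewrite ltnS leqn0 => /eqP /h1[].
by rewrite !mpolyC0 /=; ring.
Qed.

(** Cramer's rule: [X_0], [a], [b] form a basis of the linear forms, with determinant
    [crossp a b (inord 0)]. *)
Lemma normal_form_X a b d p k : crossp a b (inord 0) != 0 ->
  normal_form a b d p -> normal_form a b d.+1 ('X_k * p).
Proof.
move=> P0 nf; set l := crossp a b (inord 0) in P0.
have comb c0 c1 c2 : l%:MP * 'X_k = c0%:MP * 'X_(inord 0) + c1%:MP * lform a + c2%:MP * lform b ->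
    normal_form a b d.+1 ('X_k * p).
  move=> E; have -> : 'X_k * p = l^-1%:MP * ((c0%:MP * ('X_(inord 0) * p) +
       (c1%:MP * (lform a * p) + (c2%:MP * (lform b * p) + 0)))) + 0.
    by rewrite !addr0 !mulrA -!mulrDl !addrA -E !mulrA -mpolyCM mulVf // mpolyC1 mul1r.
  apply: normal_formD; last exact: normal_form0.
  apply: normal_formD; first exact: normal_form_X0.
  apply: normal_formD; first exact: normal_form_a.
  apply: normal_formD; first exact: normal_form_b.
  exact: normal_form0.
move: comb; rewrite /l !crossE /lform !sum3E -!mul_mpolyC.
move: k; apply: forall3 => comb.
- by apply: (comb (a (inord 1) * b (inord 2) - a (inord 2) * b (inord 1)) 0 0);
    rewrite mpolyC0; ring.
- apply: (comb (a (inord 2) * b (inord 0) - a (inord 0) * b (inord 2))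
    (b (inord 2)) (- a (inord 2))).
  by rewrite !(mpolyCB, mpolyCM, mpolyCN); ring.
- apply: (comb (a (inord 0) * b (inord 1) - a (inord 1) * b (inord 0))
    (- b (inord 1)) (a (inord 1))).
  by rewrite !(mpolyCB, mpolyCM, mpolyCN); ring.
Qed.

Lemma normal_form_monomial a b m : crossp a b (inord 0) != 0 ->
  normal_form a b (mdeg m) 'X_[m].
Proof.
move=> P0; move E : (mdeg m) => d; elim: d m E => [|d IH] m E.
  move/eqP: E; rewrite mdeg_eq0 => /eqP->; rewrite mpolyX0.
  by exists 0, 0, 1, 0, 0, 0; split=> //; rewrite mpolyC0 mpolyC1; ring.
have [k mk] : exists k, (0 < m k)%N.
  have : mdeg m != 0%N by rewrite E.
  rewrite mdegE; move/eqP => N; apply/existsP; apply: contra_notT N => /existsPn N.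
  by apply: big1 => i _; apply/eqP; rewrite -leqn0 leqNgt N.
have mE : m = (U_(k) + (m - U_(k)))%MM.
  by rewrite addmC submK // lep1mP -lt0n.
rewrite mE mpolyXD; apply: normal_form_X => //; apply: IH.
by move: E; rewrite {1}mE mdegD mdeg1 => -[].
Qed.

Lemma normal_form_homog a b d p : crossp a b (inord 0) != 0 ->
  p \is d.-homog -> normal_form a b d p.
Proof.
move=> P0 /dhomogP hp; rewrite (mpolyE p) big_seq.
apply: (big_ind (normal_form a b d)) => [|q r nq nr|m /hp <-].
- exact: normal_form0.
- by rewrite -[q]mul1r -mpolyC1; apply: normal_formD.
- rewrite -mul_mpolyC -[X in normal_form _ _ _ X]addr0.
  apply: normal_formD; last exact: normal_form0.
  exact: normal_form_monomial.
Qed.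

Lemma dirderXn0 u i n : u i = 0 -> dirder u ('X_i ^+ n) = 0.
Proof.
move=> u0; elim: n => [|n IH]; first by rewrite expr0 -mpolyC1 dirderC.
by rewrite exprS dirderM IH dirderXU u0 mpolyC0; ring.
Qed.

(** The directions annihilate [X_0], so on a normal form each functional reads off one coefficient
    times, up to sign, a power of the nonzero coordinate. *)
Lemma ideal_phi a b d p : crossp a b (inord 0) != 0 -> p \is d.-homog ->
  (forall k, phi a b k p = 0) -> in_sqideal a b p.
Proof.
move=> P0 hp phi0.
have [A [B [c0 [c1 [c2 [c3 [_ _ pE]]]]]]] := normal_form_homog P0 hp.
have [[[[[aP bP] aa] bb] ab] ba] := dot_cross a b.
have {hp} phiE k : phi a b k p = phi a b k (
    c0%:MP * 'X_(inord 0) ^+ d + c1%:MP * ('X_(inord 0) ^+ d.-1 * lform a)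
      + c2%:MP * ('X_(inord 0) ^+ d.-1 * lform b)
      + c3%:MP * ('X_(inord 0) ^+ d.-2 * (lform a * lform b))).
  rewrite pE -!addrA !phiD (phi_ideal k (p := A * lform a ^+ 2)) ?add0r; last first.
    by exists A, 0; rewrite mul0r addr0.
  rewrite (phi_ideal k (p := B * lform b ^+ 2)) ?add0r //.
  by exists 0, B; rewrite mul0r add0r.
have X0 n c : dirder (dirvec c) ('X_(inord 0) ^+ n) = 0.
  by apply: dirderXn0; rewrite dirvecE.
have dsimp := (dirderM, dirderD, dirder_lform, dirderC, X0, mul0r, mulr0, addr0, add0r).
have msimp := (mevalD, mevalM, mevalC, meval0, meval_lform, rmorphXn, mevalXU,
  aP, bP, aa, bb, ab, ba, mul0r, mulr0, addr0, add0r, mulrN, oppr0).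
have Pn n : crossp a b (inord 0) ^+ n != 0 by rewrite expf_neq0.
have c00 : c0 = 0.
  move/eqP: (phi0 (inord 0)); rewrite phiE /phi inordK //= !msimp /= mevalXU.
  by rewrite mulf_eq0 (negPf (Pn _)) orbF => /eqP.
have c10 : c1 = 0.
  move/eqP: (phi0 (inord 1)); rewrite phiE /phi inordK //= c00 mpolyC0.
  rewrite !dsimp !msimp /= mevalXU.
  by rewrite !mulf_eq0 (negPf (Pn _)) (negPf P0) !orbF => /eqP.
have c20 : c2 = 0.
  move/eqP: (phi0 (inord 2)); rewrite phiE /phi inordK //= c00 c10 mpolyC0.
  rewrite !dsimp !msimp /= mevalXU.
  by rewrite oppr_eq0 !mulf_eq0 (negPf (Pn _)) (negPf P0) !orbF => /eqP.
have c30 : c3 = 0.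
  move/eqP: (phi0 (inord 3)); rewrite phiE /phi inordK //= c00 c10 c20 mpolyC0.
  do 2! rewrite ?dsimp. rewrite !msimp /= mevalXU.
  by rewrite ?oppr_eq0 !mulf_eq0 ?oppr_eq0 (negPf (Pn _)) (negPf P0) !orbF => /eqP.
by exists A, B; rewrite pE c00 c10 c20 c30 mpolyC0 !mul0r !addr0.
Qed.

End DoubleIdeal.

(** * Forms of degree [d] and lattice points *)

Section Monomials.
Variable F : fieldType.
Variable d : nat.

Definition expo (m : nat * nat) : 'X_{1..3} :=
  [multinom nth 0%N [:: d - m.1 - m.2; m.1; m.2]%N i | i < 3].

Lemma expoE m : (expo m (inord 0) = d - m.1 - m.2)%N * (expo m (inord 1) = m.1)
  * (expo m (inord 2) = m.2).
Proof. by rewrite /expo !mnmE !inordK. Qed.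

Lemma expo_inj : injective expo.
Proof.
move=> [i j] [i' j'] E.
by have := expoE (i, j); rewrite E !expoE => -[[_ /= ->] ->].
Qed.

Lemma mdeg_expo m : m \in tri 0 d.+1 -> mdeg (expo m) = d.
Proof. by case: m => i j; rewrite mem_tri mdegE sum3E !expoE /=; lia. Qed.

Lemma expo_mdeg e : mdeg e = d -> exists2 m, m \in tri 0 d.+1 & e = expo m.
Proof.
rewrite mdegE sum3E => ed; exists (e (inord 1), e (inord 2)).
  by rewrite mem_tri /=; lia.
by apply/mnmP; apply: forall3; rewrite !expoE //=; lia.
Qed.

Lemma uniq_tri r n : uniq (tri r n).
Proof.
elim: n r => [//|n IH] r; rewrite triS cat_uniq IH andbT.
rewrite map_inj_uniq ?iota_uniq => [|i j []//]; apply/hasPn => m.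
by rewrite mem_tri mem_hrow => /andP[lt _]; rewrite (gtn_eqF lt).
Qed.

Lemma size_tri r n : size (tri r n) = 'C(n.+1, 2).
Proof.
elim: n r => [//|n IH] r.
by rewrite triS size_cat size_map size_iota IH [RHS]binS bin1 addnC.
Qed.

Lemma homog_tri (p : {mpoly F[3]}) : p \is d.-homog ->
  p = \sum_(m <- tri 0 d.+1) p@_(expo m) *: 'X_[expo m].
Proof.
move=> hp; apply/mpolyP => e; rewrite raddf_sum /=.
have [/expo_mdeg[m mT ->]|ed] := eqVneq (mdeg e) d.
  rewrite (bigD1_seq m) ?uniq_tri //= mcoeffZ mcoeffX eqxx mulr1 big1 ?addr0 //.
  by move=> m' mm; rewrite mcoeffZ mcoeffX (inj_eq expo_inj) (negPf mm) mulr0.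
rewrite (dhomog_nemf_coeff hp ed) big1_seq // => m /= mT.
rewrite mcoeffZ mcoeffX; case: eqP => [E|]; last by rewrite mulr0.
by rewrite -E mdeg_expo ?eqxx in ed.
Qed.

End Monomials.

(** * Directional derivatives of monomials off the coordinate lines *)

Section LogDerivative.
Variable F : fieldType.
Variables (x : 'I_3 -> F) (x_neq0 : forall k, x k != 0).
Implicit Types (u w : 'I_3 -> F) (e : 'X_{1..3}).

Definition logder u e : F := \sum_k u k / x k * (e k)%:R.

Lemma meval_divX e k :
  (e k)%:R * ('X_[e - U_(k)] : {mpoly F[3]}).@[x] = (e k)%:R / x k * 'X_[e].@[x].
Proof.
(* When [e k = 0] the truncated exponent [e - U_(k)] comes with coefficient zero. *)
case: (posnP (e k)) => [->|ek]; first by rewrite !mul0r.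
have eE : e = (e - U_(k) + U_(k))%MM by rewrite submK // lep1mP -lt0n.
have -> : ('X_[e] : {mpoly F[3]}).@[x] = ('X_[e - U_(k)] : {mpoly F[3]}).@[x] * x k.
  by rewrite {1}eE mpolyXD mevalM mevalXU.
by field.
Qed.

Lemma meval_dirderX u e : (dirder u 'X_[e]).@[x] = logder u e * 'X_[e].@[x].
Proof.
rewrite /dirder /logder raddf_sum mulr_suml; apply: eq_bigr => k _ /=.
by rewrite mderivX !mevalZ meval_divX; ring.
Qed.

(** Passing from [e] to [e - U_(k)] lowers [logder u] by [u k / x k], whence the correction sum. *)
Lemma meval_dirder2X u w e : (dirder u (dirder w 'X_[e])).@[x] =
  (logder u e * logder w e - \sum_k u k / x k * (w k / x k) * (e k)%:R) * 'X_[e].@[x].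
Proof.
rewrite {2}/dirder dirder_sum raddf_sum /= [X in _ * X - _]/logder.
rewrite [X in (X - _) * _]mulr_sumr -sumrB mulr_suml; apply: eq_bigr => k _ /=.
rewrite mderivX !dirderZ !mevalZ meval_dirderX.
case: (posnP (e k)) => [->|ek]; first by ring.
have -> : logder u (e - U_(k))%MM = logder u e - u k / x k.
  rewrite /logder (bigD1 k) //= [in RHS](bigD1 k) //= mnmBE mnm1E eqxx natrB //.
  rewrite (eq_bigr (fun i => u i / x i * (e i)%:R)); first by rewrite -[true%:R]/(1 : F); ring.
  by move=> i ik; rewrite mnmBE mnm1E eq_sym (negPf ik) subn0.
have -> : w k * ((e k)%:R * ((logder u e - u k / x k) * ('X_[e - U_(k)] : {mpoly F[3]}).@[x]))
  = w k * (logder u e - u k / x k) * ((e k)%:R * ('X_[e - U_(k)] : {mpoly F[3]}).@[x]) by ring.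
by rewrite meval_divX; field.
Qed.

End LogDerivative.

(** * Linear forms realising an abstract square *)

Section SquareForms.
Variable F : closedFieldType.
Variables (d : nat) (c : square F) (vc : valid c).

(* The two linear forms of the square [c], normalised so that their cross product
   is [(1, px c, py c)]. *)
Definition form_scale : F := px c * py c * (mu2 c * nu1 c - mu1 c * nu2 c).

Definition form_b : 'I_3 -> F := fun k =>
  [:: px c * py c * (mu2 c - mu1 c); - (py c * mu2 c); px c * mu1 c]`_k.

Definition form_a : 'I_3 -> F := fun k =>
  [:: px c * py c * (nu2 c - nu1 c); - (py c * nu2 c); px c * nu1 c]`_k / form_scale.

Lemma form_bE : (form_b (inord 0) = px c * py c * (mu2 c - mu1 c)) *
  (form_b (inord 1) = - (py c * mu2 c)) * (form_b (inord 2) = px c * mu1 c).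
Proof. by rewrite /form_b !inordK. Qed.

Lemma form_aE : (form_a (inord 0) = px c * py c * (nu2 c - nu1 c) / form_scale) *
  (form_a (inord 1) = - (py c * nu2 c) / form_scale) *
  (form_a (inord 2) = px c * nu1 c / form_scale).
Proof. by rewrite /form_a !inordK. Qed.

Lemma form_scale_neq0 : form_scale != 0.
Proof.
have /and3P[x0 y0 l0] := vc.
by rewrite !mulf_neq0 // -oppr_eq0 opprB.
Qed.

Lemma cross_form : (crossp form_a form_b (inord 0) = 1) *
  (crossp form_a form_b (inord 1) = px c) * (crossp form_a form_b (inord 2) = py c).
Proof.
have /and3P[x0 y0 _] := vc; have := form_scale_neq0.
rewrite !crossE !form_aE !form_bE /form_scale mulf_eq0 negb_or => /andP[_ l0].
by do !split; field; rewrite x0 y0 l0.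
Qed.

(** After division by the point, [dirvec form_b] is [mu] and [dirvec form_a] is [nu / form_scale];
    the latter enters only for [k >= 2]. *)
Lemma phi_form k m :
  phi form_a form_b k 'X_[expo d m] =
  (if (k < 2)%N then 1 else form_scale^-1) * cond c k m.
Proof.
have /and3P[x0 y0 l0] := vc; have s0 := form_scale_neq0.
have n0 : forall k, crossp form_a form_b k != 0.
  by apply: forall3; rewrite ?cross_form ?oner_neq0.
have XE : ('X_[expo d m] : {mpoly F[3]}).@[crossp form_a form_b] =
    px c ^+ m.1 * py c ^+ m.2.
  rewrite mevalX !big_ord_recl big_ord0.
  have [-> -> ->] : [/\ ord0 = inord 0 :> 'I_3, lift ord0 ord0 = inord 1 :> 'I_3
       & lift ord0 (lift ord0 ord0) = inord 2 :> 'I_3].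
    by split; apply: val_inj; rewrite /= inordK.
  by rewrite !cross_form !expoE expr1n mul1r mulr1.
rewrite /phi /cond; case: k => [[|[|[|[|//]]]] lt] /=.
- by rewrite XE; ring.
- rewrite meval_dirderX // XE /logder sum3E !cross_form !expoE !dirvecE !form_bE.
  by field; rewrite x0 y0 oner_neq0.
- rewrite meval_dirderX // XE /logder sum3E !cross_form !expoE !dirvecE !form_aE.
  by field; rewrite x0 y0 s0 ?oner_neq0.
- rewrite meval_dirder2X // XE /logder !sum3E !cross_form !expoE !dirvecE !form_aE !form_bE.
  by field; rewrite x0 y0 s0 ?oner_neq0.
Qed.

End SquareForms.

(** * Polynomial dependence on the parameters *)

Section PolynomialFunctions.
Variables (F : fieldType) (n : nat).
Implicit Types f g : ('I_n -> F) -> F.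

Definition polyfun f := exists p : {mpoly F[n]}, forall v, p.@[v] = f v.

Lemma polyfun_ext f g : f =1 g -> polyfun f -> polyfun g.
Proof. by move=> fg [p pE]; exists p => v; rewrite pE. Qed.

Lemma polyfun_const c : polyfun (fun=> c).
Proof. by exists c%:MP => v; rewrite mevalC. Qed.

Lemma polyfun_coord i : polyfun (fun v => v i).
Proof. by exists 'X_i => v; rewrite mevalXU. Qed.

Lemma polyfunD f g : polyfun f -> polyfun g -> polyfun (fun v => f v + g v).
Proof. by move=> [p pE] [q qE]; exists (p + q) => v; rewrite mevalD pE qE. Qed.

Lemma polyfunM f g : polyfun f -> polyfun g -> polyfun (fun v => f v * g v).
Proof. by move=> [p pE] [q qE]; exists (p * q) => v; rewrite mevalM pE qE. Qed.

Lemma polyfunN f : polyfun f -> polyfun (fun v => - f v).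
Proof. by move=> [p pE]; exists (- p) => v; rewrite mevalN pE. Qed.

Lemma polyfun_sum (I : Type) (r : seq I) (P : pred I) (f : I -> ('I_n -> F) -> F) :
  (forall i, polyfun (f i)) -> polyfun (fun v => \sum_(i <- r | P i) f i v).
Proof.
move=> pf; elim: r => [|i r IH].
  by apply: polyfun_ext (polyfun_const 0) => v; rewrite big_nil.
apply: (@polyfun_ext (fun v => (if P i then f i v else 0) + \sum_(j <- r | P j) f j v)).
  by move=> v; rewrite big_cons; case: ifP => // _; rewrite add0r.
by apply: polyfunD => //; case: (P i) => //; apply: polyfun_const.
Qed.

Lemma polyfun_prod (I : Type) (r : seq I) (P : pred I) (f : I -> ('I_n -> F) -> F) :
  (forall i, polyfun (f i)) -> polyfun (fun v => \prod_(i <- r | P i) f i v).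
Proof.
move=> pf; elim: r => [|i r IH].
  by apply: polyfun_ext (polyfun_const 1) => v; rewrite big_nil.
apply: (@polyfun_ext (fun v => (if P i then f i v else 1) * \prod_(j <- r | P j) f j v)).
  by move=> v; rewrite big_cons; case: ifP => // _; rewrite mul1r.
by apply: polyfunM => //; case: (P i) => //; apply: polyfun_const.
Qed.

Lemma polyfunX f k : polyfun f -> polyfun (fun v => f v ^+ k).
Proof.
move=> pf; elim: k => [|k IH]; first exact: polyfun_const.
by apply: polyfun_ext (polyfunM pf IH) => v; rewrite exprS.
Qed.

Lemma polyfun_meval m (p : {mpoly F[m]}) (f : 'I_m -> ('I_n -> F) -> F) :
  (forall k, polyfun (f k)) -> polyfun (fun v => p.@[fun k => f k v]).
Proof.
move=> pf; apply: (polyfun_ext (f := fun v =>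
    \sum_(e <- msupp p) p@_e * \prod_i f i v ^+ e i)).
  by move=> v; rewrite mevalE.
apply: polyfun_sum => e; apply: polyfunM; first exact: polyfun_const.
by apply: polyfun_prod => i; apply: polyfunX.
Qed.

Lemma polyfun_det m (A : ('I_n -> F) -> 'M[F]_m) :
  (forall i j, polyfun (fun v => A v i j)) -> polyfun (fun v => \det (A v)).
Proof.
move=> pA; apply: polyfun_sum => s; apply: polyfunM; first exact: polyfun_const.
by apply: polyfun_prod.
Qed.

Lemma polyfun_phi (a b : 'I_3 -> ('I_n -> F) -> F) k p :
    (forall i, polyfun (a i)) -> (forall i, polyfun (b i)) ->
  polyfun (fun v => phi (fun i => a i v) (fun i => b i v) k p).
Proof.
move=> pa pb.
have pX : forall i, polyfun (fun v => crossp (fun i => a i v) (fun i => b i v) i).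
  by move=> [[|[|i]] lt]; rewrite /crossp /=; apply: polyfunD; try apply: polyfunN;
    apply: polyfunM.
have pV (f : 'I_3 -> ('I_n -> F) -> F) : (forall i, polyfun (f i)) ->
    forall i, polyfun (fun v => dirvec (fun i => f i v) i).
  move=> pf [[|[|i]] lt]; rewrite /dirvec /=; first exact: polyfun_const.
    exact: pf.
  exact: polyfunN.
have pE q : polyfun (fun v => q.@[crossp (fun i => a i v) (fun i => b i v)]).
  exact: (polyfun_meval q pX).
rewrite /phi; case: k => [[|[|[|[|//]]]] lt] /=.
- exact: pE.
- apply: (polyfun_ext (f := fun v => \sum_i dirvec (fun i => b i v) i *
    (p^`M(i)).@[crossp (fun i => a i v) (fun i => b i v)])).
    by move=> v; rewrite /dirder raddf_sum; apply: eq_bigr => i _ /=; rewrite mevalZ.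
  by apply: polyfun_sum => i; apply: polyfunM; [exact: pV|exact: pE].
- apply: (polyfun_ext (f := fun v => \sum_i dirvec (fun i => a i v) i *
    (p^`M(i)).@[crossp (fun i => a i v) (fun i => b i v)])).
    by move=> v; rewrite /dirder raddf_sum; apply: eq_bigr => i _ /=; rewrite mevalZ.
  by apply: polyfun_sum => i; apply: polyfunM; [exact: pV|exact: pE].
- apply: (polyfun_ext (f := fun v => \sum_j dirvec (fun i => a i v) j *
   \sum_i dirvec (fun i => b i v) i *
    (p^`M(j)^`M(i)).@[crossp (fun i => a i v) (fun i => b i v)])).
    move=> v; rewrite [dirder (dirvec (fun i => a i v)) _]/dirder dirder_sum raddf_sum.
    apply: eq_bigr => i _ /=; rewrite dirderZ mevalZ /dirder raddf_sum.
    by congr (_ * _); apply: eq_bigr => j _ /=; rewrite mevalZ.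
  apply: polyfun_sum => i; apply: polyfunM; first exact: pV.
  by apply: polyfun_sum => j; apply: polyfunM; [exact: pV|exact: pE].
Qed.

End PolynomialFunctions.

(** * The evaluation matrix and its generic rank *)

Section EvaluationMatrix.
Variable F : closedFieldType.
Hypothesis F_char0 : forall n : nat, n.+1%:R != 0 :> F.
Variables (s d : nat).
Implicit Type v : 'I_(nparams s) -> F.

Definition coefs v (i : 'I_s) (j : 'I_2) : 'I_3 -> F :=
  fun k => v (enum_rank ((i, j, k) : param_index s)).

Definition mono (i : 'I_(size (tri 0 d.+1))) : {mpoly F[3]} :=
  'X_[expo d (tnth (in_tuple (tri 0 d.+1)) i)].

Definition evalmx v : 'M[F]_(size (tri 0 d.+1), #|{: 'I_s * 'I_4}|) :=
  \matrix_(i, j) phi (coefs v (enum_val j).1 0) (coefs v (enum_val j).1 1)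
    (enum_val j).2 (mono i).

Lemma evalmx_kernel v (u : 'rV_(size (tri 0 d.+1))) :
  u *m evalmx v = 0 <-> forall i k, phi (coefs v i 0) (coefs v i 1) k
    (\sum_j u 0 j *: mono j) = 0.
Proof.
split=> [uN i k|uN].
  move/rowP/(_ (enum_rank (i, k))): uN; rewrite !mxE phi_sum => uN.
  rewrite -[RHS]uN; apply: eq_bigr => j _; by rewrite !mxE enum_rankK.
apply/rowP => j; rewrite !mxE -[RHS](uN (enum_val j).1 (enum_val j).2) phi_sum.
by apply: eq_bigr => i _; rewrite !mxE.
Qed.

Lemma homog_mono p : p \is d.-homog <->
  exists u : 'rV_(size (tri 0 d.+1)), p = \sum_j u 0 j *: mono j.
Proof.
split=> [/homog_tri pE|[u ->]].
  exists (\row_j p@_(expo d (tnth (in_tuple (tri 0 d.+1)) j))).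
  by rewrite {1}pE big_tnth; apply: eq_bigr => j _; rewrite mxE.
apply: rpred_sum => j _; apply: rpredZ; rewrite dhomogX.
by apply/eqP; apply: mdeg_expo; apply: mem_tnth.
Qed.

Lemma mono_free (u : 'rV_(size (tri 0 d.+1))) :
  \sum_j u 0 j *: mono j = 0 -> u = 0.
Proof.
move=> u0; apply/rowP => i.
have /(congr1 (fun p => p@_(expo d (tnth (in_tuple (tri 0 d.+1)) i)))) := u0.
rewrite raddf_sum (bigD1 i) //= mcoeffZ mcoeffX eqxx mulr1 big1 ?addr0 => [->|].
  by rewrite mcoeff0 mxE.
move=> j ji; rewrite mcoeffZ mcoeffX (inj_eq (@expo_inj d)).
rewrite !(tnth_nth (0, 0)%N) nth_uniq ?uniq_tri //= .
by rewrite (inj_eq val_inj) (negPf ji) mulr0.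
Qed.

(** With [W] a right inverse of the rows [D] at the peeled configuration [v0], the determinant of
    these rows times [W] is polynomial in [v] and [1] at [v0]. Where it is nonzero the rank is at
    least [size D]; the matrix size bounds it above. The other factor of [G] keeps all supports in
    the chart. *)
Lemma generic_rank : exists2 G : {mpoly F[nparams s]}, G != 0 &
  forall v, G.@[v] != 0 ->
    (forall i, crossp (coefs v i 0) (coefs v i 1) (inord 0) != 0) /\
    \rank (evalmx v) = minn (4 * s) (size (tri 0 d.+1)).
Proof.
have [D [sub uD szD [cs vs sD]]] := splits_tri F_char0 0 d.+1 s.
pose v0 : 'I_(nparams s) -> F := fun p =>
  let: (i, j, k) := (enum_val p : param_index s) in
  (if j == 0 then form_a (cs i) else form_b (cs i)) k.
have v0a i k : coefs v0 i 0 k = form_a (cs i) k by rewrite /coefs /v0 enum_rankK.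
have v0b i k : coefs v0 i 1 k = form_b (cs i) k by rewrite /coefs /v0 enum_rankK.
have v0phi i k m :
    phi (coefs v0 i 0) (coefs v0 i 1) k 'X_[expo d m] =
    (if (k < 2)%N then 1 else (form_scale (cs i))^-1) * cond (cs i) k m.
  rewrite -(@phi_form _ d) ?vs //; congr (phi _ _ _ _).
    exact: functional_extensionality.
  exact: functional_extensionality.
pose N := size (tri 0 d.+1).
have lt_index (i : 'I_(size D)) : (index (nth (0, 0)%N D i) (tri 0 d.+1) < N)%N.
  by rewrite index_mem sub // mem_nth.
pose h (i : 'I_(size D)) : 'I_N := Ordinal (lt_index i).
have hE i : tnth (in_tuple (tri 0 d.+1)) (h i) = nth (0, 0)%N D i.
  by rewrite (tnth_nth (0, 0)%N) /= nth_index // sub // mem_nth.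
have /row_freeP[W AW] : row_free (rowsub h (evalmx v0)).
  rewrite -kermx_eq0; apply/rowV0P => u /sub_kermxP uN.
  pose f m := oapp (u 0) 0 (insub (index m D) : option 'I_(size D)).
  have fE (i : 'I_(size D)) : f (nth (0, 0)%N D i) = u 0 i.
    by rewrite /f index_uniq // valK.
  suff f0 : {in D, forall m, f m = 0}.
    by apply/rowP => i; rewrite mxE -fE f0 ?mem_nth.
  apply: sD => -[i k]; rewrite (big_nth (0, 0)%N) big_mkord.
  have /rowP/(_ (enum_rank (i, k))) := uN; rewrite !mxE => E.
  (* The columns agree with [cond] up to this nonzero factor. *)
  have t0 : (if (k < 2)%N then 1 else (form_scale (cs i))^-1) != 0.
    by case: ifP => _; rewrite ?oner_eq0 // invr_eq0 form_scale_neq0 // vs.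
  apply: (mulfI t0); rewrite mulr0 -[RHS]E mulr_sumr; apply: eq_bigr => j _.
  rewrite fE !mxE enum_rankK /= /mono hE v0phi /conds /=.
  by ring.
have [p pE] : polyfun (fun v => \det (rowsub h (evalmx v) *m W) *
    \prod_i crossp (coefs v i 0) (coefs v i 1) (inord 0)).
  apply: polyfunM.
    apply: polyfun_det => i j; apply: (polyfun_ext (f := fun v =>
      \sum_k evalmx v (h i) k * W k j)).
      by move=> v; rewrite mxE; apply: eq_bigr => k _; rewrite [in RHS]mxE.
    apply: polyfun_sum => k; apply: polyfunM; last exact: polyfun_const.
    apply: (polyfun_ext (f := fun v => phi (coefs v (enum_val k).1 0)
      (coefs v (enum_val k).1 1) (enum_val k).2 (mono (h i)))).
      by move=> v; rewrite mxE.
    by apply: polyfun_phi => l; apply: polyfun_coord.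
  apply: polyfun_prod => i; rewrite /crossp /= inordK //.
  by apply: polyfunD; [|apply: polyfunN]; apply: polyfunM; apply: polyfun_coord.
exists p => [|v].
  apply/eqP => p0; have := pE v0; rewrite p0 meval0 AW det1 mul1r.
  rewrite big1 => [/eqP|i _]; first by rewrite eq_sym oner_eq0.
  rewrite (_ : coefs v0 i 0 = form_a (cs i)); last exact: functional_extensionality.
  rewrite (_ : coefs v0 i 1 = form_b (cs i)); last exact: functional_extensionality.
  by rewrite cross_form ?vs.
rewrite pE mulf_eq0 negb_or => /andP[dt /prodf_neq0 P0].
split=> [i|]; first exact: P0.
apply/eqP; rewrite eqn_leq; apply/andP; split.
  rewrite leq_min rank_leq_row andbT; apply: leq_trans (rank_leq_col _) _.
  by rewrite card_prod !card_ord mulnC.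
rewrite -szD; have : rowsub h (evalmx v) *m W \in unitmx by rewrite unitmxE unitfE.
move=> /mxrank_unit {1}<-; apply: leq_trans (mxrankM_maxl _ _) _.
by rewrite rowsubE mxrankM_maxr.
Qed.

End EvaluationMatrix.

Lemma CC_char0 n : n.+1%:R != 0 :> CC.
Proof.
have : n.+1%:R != 0 :> complex R by rewrite Num.Theory.pnatr_eq0.
by [].
Qed.

(** * Dimension of [I(X)_d] as a kernel dimension *)

Section Kernel.
Variables (s d : nat) (v : 'I_(nparams s) -> CC).
Hypothesis supp_chart : forall i, crossp (coefs v i 0) (coefs v i 1) (inord 0) != 0.

Let N := size (tri 0 d.+1).

Lemma IX_dP p : IX_d v d p <->
  exists2 u : 'rV_N, p = \sum_j u 0 j *: mono CC j & u *m evalmx d v = 0.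
Proof.
split=> [[hp ip]|[u pE uN]].
  have [u pE] := (homog_mono d p).1 hp; exists u => //.
  apply/evalmx_kernel => i k; rewrite -pE.
  exact: (@phi_ideal _ (coefs v i 0) (coefs v i 1) k p (ip i)).
have hp : p \is d.-homog for mdeg by apply/homog_mono; exists u.
split=> // i; apply: (ideal_phi (supp_chart i) hp) => k.
by rewrite pE; apply: (evalmx_kernel v u).1.
Qed.

(** A row basis of the left kernel gives the basis of forms; [mono_free] transfers independence. *)
Lemma has_dim_IX_d : has_dim (IX_d v d) (N - \rank (evalmx d v)).
Proof.
rewrite -mxrank_ker; set B := row_base (kermx (evalmx d v)).
pose pol (u : 'rV_N) := \sum_j u 0 j *: mono CC j.
have polB (c : 'I_(\rank (kermx (evalmx d v))) -> CC) :
    \sum_i c i *: pol (row i B) = pol ((\row_i c i) *m B).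
  under eq_bigr do rewrite /pol scaler_sumr.
  rewrite exchange_big; apply: eq_bigr => j _ /=.
  rewrite mxE scaler_suml; apply: eq_bigr => i _.
  by rewrite !mxE scalerA.
exists (fun i => pol (row i B)); split=> [i|]; last split.
- apply/IX_dP; exists (row i B) => //; apply/sub_kermxP.
  by apply: submx_trans (row_sub _ _) _; rewrite eq_row_base.
- move=> c; rewrite polB => /mono_free/eqP.
  rewrite mulmx_free_eq0 ?row_base_free // => /eqP c0 i.
  by have /rowP/(_ i) := c0; rewrite !mxE.
- move=> p /IX_dP[u -> /sub_kermxP]; rewrite -(eq_row_base (kermx _)) => /submxP[c ->].
  exists (c 0); rewrite polB (_ : \row_i c 0 i = c) //.
  by apply/rowP => i; rewrite mxE.
Qed.

End Kernel.

(* "General union": the claimed equality holds for all configurations in a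
   nonempty Zariski-open subset (complement of the zero locus of a nonzero
   polynomial G) of the parameter space of s 2-squares. *)
Theorem theorem3p1 (s : nat) (hs : (1 <= s)%N) (d : nat) :
  exists G : {mpoly CC[nparams s]}, G != 0 /\
    forall v : 'I_(nparams s) -> CC,
      valid_config v -> G.@[v] != 0 ->
      has_dim (IX_d v d) (maxn 0 ('C(d.+2, 2) - 4 * s)).
Proof.
have [G G0 HG] := generic_rank CC_char0 s d.
exists G; split=> // v _ /HG[P0 rk].
(* The binomial counts the lattice triangle; truncated subtraction accounts for the maximum with
   [0]. *)
rewrite max0n -(size_tri 0) (_ : _ - _ = size (tri 0 d.+1) - \rank (evalmx d v))%N.
  exact: has_dim_IX_d.
by rewrite rk; lia.
Qed.
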